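(* Let $Q$ be a valued cluster quiver with $n=|Q_0|$ and connected components $Q'_1,\dots,Q'_s$. Let $B(Q)=(b_{ij})_{n\times n}$ be its exchange matrix and $C(Q)=(c_{ij})_{n\times n}$ the adjacency matrix of its underlying valued graph $\bar Q$. For $i\in Q_0$ let $h_i=\sum_{j=1}^n|b_{ij}|=\sum_{j=1}^n c_{ij}$, and let $h=\max\{h_1,\dots,h_n\}$. For $1\le p\le s$ let $r_p=\max_{i\in (Q'_p)_0}\sum_{j\in (Q'_p)_0}|b_{ij}|$, and let $r=\max\{r_1,\dots,r_s\}$. Let $\lambda$ be the exchange spectrum radius of $Q$ and $\mu$ the adjacency spectrum radius of the valued graph $\bar Q$. Then $$0\le\lambda\le\mu\le h=r.$$
   Context: A valued cluster quiver $(Q,v)$ (written $Q$) is a finite quiver (oriented graph with vertex set $Q_0=\{1,\dots,n\}$ and arrow set $Q_1$) without loops and with at most one arrow between any pair of vertices (so in particular no oriented 2-cycles), together with a map $v:Q_1\to\mathbb{Z}_{>0}^2$, $v(\alpha)=(v(\alpha)_1,v(\alpha)_2)$, for which there is a map $d:Q_0\to\mathbb{Z}_{>0}$ such that $d(i)v(\alpha)_1=d(j)v(\alpha)_2$ for each arrow $\alpha:i\to j$. For an arrow $\alpha:i\to j$ write $v_{ij}=v(\alpha)_1$, $v_{ji}=v(\alpha)_2$. The exchange matrix $B(Q)=(b_{ij})_{n\times n}$ is defined by $b_{ij}=v_{ij}$ if there is an arrow $i\to j$, $b_{ij}=-v_{ij}$ if there is an arrow $j\to i$, and $b_{ij}=0$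 otherwise. The adjacency matrix of the underlying valued graph $\bar Q$ is $C(Q)=(|b_{ij}|)_{n\times n}$. The exchange spectrum radius of $Q$ is the maximum modulus of the (complex) eigenvalues of $B(Q)$, and the adjacency spectrum radius of $\bar Q$ is the maximum modulus of the eigenvalues of $C(Q)$. Connected components of $Q$ are the full valued subquivers on the vertex sets of the connected components of the underlying graph. *)

(* Defs.v *)
From HB Require Import structures.
From mathcomp Require Import all_boot all_order all_algebra.
From mathcomp Require Import reals.
From mathcomp Require Import complex.

Set Implicit Arguments.
Unset Strict Implicit.
Unset Printing Implicit Defensive.

Import Order.TTheory GRing.Theory Num.Theory.
Import ComplexField.Normc.
Local Open Scope ring_scope.
Local Open Scope complex_scope.

Record valued_cluster_quiver (n : nat) := ValuedClusterQuiver {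
  arrow : finType;
  source : arrow -> 'I_n;
  target : arrow -> 'I_n;
  valuation : arrow -> nat * nat;
  no_loop : forall a, source a != target a;
  one_arrow : forall a b,
    [set source a; target a] = [set source b; target b] -> a = b;
  valuation_gt0 : forall a, (0 < (valuation a).1)%N /\ (0 < (valuation a).2)%N;
  symmetrizable : exists d : 'I_n -> nat,
    (forall i, (0 < d i)%N) /\
    (forall a, d (source a) * (valuation a).1 =
               d (target a) * (valuation a).2)%N
}.

Section Quiver.
Variables (n : nat) (Q : valued_cluster_quiver n).
Implicit Types i j : 'I_n.

Definition arrow_from_to i j : option (arrow Q) :=
  [pick a | (source a == i) && (target a == j)].

Definition exchange_matrix : 'M[int]_n :=
  \matrix_(i, j)
    if arrow_from_to i j is Some a then (valuation a).1%:Z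
    else if arrow_from_to j i is Some a then - (valuation a).2%:Z
    else 0.

Definition adjacency_matrix : 'M[int]_n :=
  \matrix_(i, j) `|exchange_matrix i j|.

Definition underlying_edge : rel 'I_n :=
  fun i j => arrow_from_to i j || arrow_from_to j i.

(* A component is represented by its vertex set: it is a full subquiver. *)
Definition components : {set {set 'I_n}} :=
  [set [set j | connect underlying_edge i j] | i : 'I_n].

(* [`|_|%N] is the absolute value of an integer, as a natural number. The
   maximum of natural numbers over an empty range, which occurs only for
   n = 0, is 0. *)
Definition max_row_sum : nat :=
  (\max_(i < n) \sum_(j < n) `|exchange_matrix i j|)%N.

Definition component_max_row_sum (P : {set 'I_n}) : nat :=
  (\max_(i in P) \sum_(j in P) `|exchange_matrix i j|)%N.

Definition max_component_row_sum : nat :=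
  (\max_(P in components) component_max_row_sum P)%N.

Lemma row_sum_adjacency i :
  (\sum_(j < n) `|exchange_matrix i j|)%N%:Z = \sum_j adjacency_matrix i j.
Proof.
rewrite (big_morph Posz PoszD (erefl _)); apply: eq_bigr => j _.
by rewrite [RHS]mxE abszE.
Qed.

End Quiver.

Section SpectralRadius.
Variables (R : realType) (n : nat).
Implicit Type A : 'M[int]_n.

Definition complex_mx A : 'M[R[i]]_n := map_mx intr A.

Definition complex_eigenvalues A : seq R[i] :=
  sval (closed_field_poly_normal (char_poly (complex_mx A))).

(* The default value 0 of the maximum matters only for n = 0, see
   [spectral_radius_attained] for n > 0. *)
Definition spectral_radius A : R :=
  \big[Num.max/0]_(z <- complex_eigenvalues A) normc z.

Lemma mem_complex_eigenvalues A z :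
  (z \in complex_eigenvalues A) = eigenvalue (complex_mx A) z.
Proof.
rewrite eigenvalue_root_char /complex_eigenvalues.
case: closed_field_poly_normal => s /= Ds.
rewrite [in RHS]Ds rootZ ?root_prod_XsubC //.
by rewrite lead_coef_eq0 monic_neq0 // char_poly_monic.
Qed.

Lemma normc_le_spectral_radius A z :
  eigenvalue (complex_mx A) z -> normc z <= spectral_radius A.
Proof.
rewrite -mem_complex_eigenvalues => zs; rewrite /spectral_radius.
exact: le_bigmax_seq.
Qed.

Lemma spectral_radius_attained A : (0 < n)%N ->
  exists2 z, eigenvalue (complex_mx A) z & normc z = spectral_radius A.
Proof.
move=> n_gt0.
have s_neq0 : complex_eigenvalues A != [::].
  apply/eqP; rewrite /complex_eigenvalues.
  case: closed_field_poly_normal => s /= Ds s0.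
  have := size_char_poly (complex_mx A).
  rewrite Ds s0 big_nil (eqP (char_poly_monic _)) scale1r size_poly1.
  by case: (n) n_gt0.
suff [z zs <-] : exists2 z, z \in complex_eigenvalues A &
    normc z = spectral_radius A.
  by exists z => //; rewrite -mem_complex_eigenvalues.
rewrite /spectral_radius.
have normc_ge0 (z : R[i]) : 0 <= normc z.
  by case: z => a b; apply: sqrtr_ge0.
elim: (complex_eigenvalues A) s_neq0 => // x [|y s] IHs _.
  by exists x; rewrite ?mem_head // big_seq1_id max_l.
have [z zs Dz] := IHs isT.
rewrite big_cons -Dz.
have [le_xz | le_zx] := leP (normc x) (normc z).
  by exists z; rewrite ?inE ?zs ?orbT // -in_cons zs orbT.
by exists x; rewrite ?mem_head.
Qed.

End SpectralRadius.

Definition exchange_spectrum_radius (R : realType) (n : nat)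
  (Q : valued_cluster_quiver n) : R := spectral_radius R (exchange_matrix Q).

Definition adjacency_spectrum_radius (R : realType) (n : nat)
  (Q : valued_cluster_quiver n) : R := spectral_radius R (adjacency_matrix Q).

(* Main.v *)
Require Import Defs.
From mathcomp Require Import all_boot all_order all_algebra.
From mathcomp Require Import reals.
From mathcomp Require Import complex.

Set Implicit Arguments.
Unset Strict Implicit.
Unset Printing Implicit Defensive.

Import Order.TTheory GRing.Theory Num.Theory.
Import ComplexField.Normc.
Local Open Scope ring_scope.
Local Open Scope sesquilinear_scope.
Local Open Scope complex_scope.

(** The vertices of a connected component see all their neighbours inside it,
    so splitting into components does not change any row sum: this is [h = r].

    The bound [mu <= h] is the usual estimate of an eigenvalue by the largest
    absolute row sum ([norm_eigenvalue_le_row_sum]).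

    For [lambda <= mu], the moduli of the entries of the exchange matrix need
    not be symmetric, but [d i * |b i j| = d j * |b j i|]. Conjugating by the
    diagonal matrix of the square roots of the [d i] turns the adjacency matrix
    into a real symmetric matrix [T] and the exchange matrix into a matrix [S]
    whose entries have the entries of [T] as moduli. Let [y] be a left
    eigenvector of [S] for [z], [y'] its conjugate transpose, and [w] the row of
    the moduli of its entries, with transpose [w']. Then
    [|z| (y y') = |y S y'| <= w T w'], and by the spectral theorem [w T w'] is
    at most the spectral radius of [T] times [w w' = y y'].
    Since [T] is similar to the adjacency matrix, its spectral radius is [mu].
    The two steps are [norm_eigenvalue_le_of_symmetrizable] and
    [hermitian_form_le]. *)

(** * Bounds for eigenvalues and Hermitian forms *)

(** The [l^1] norm of a left eigenvector is multiplied by [|z|] under the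
    matrix, and by at most [h] by the triangle inequality. *)
Lemma norm_eigenvalue_le_row_sum (K : numFieldType) n (A : 'M[K]_n) (h z : K) :
  (forall i, \sum_j `|A i j| <= h) -> eigenvalue A z -> `|z| <= h.
Proof.
move=> Ah /eigenvalueP[v vA v_neq0].
have v_gt0 : 0 < \sum_j `|v 0 j|.
  rewrite lt_def sumr_ge0 // andbT; apply: contra_neq v_neq0 => v0.
  apply/rowP => j; rewrite mxE; apply/eqP; rewrite -normr_eq0.
  move/eqP: v0; rewrite psumr_eq0 // => /allP v0.
  exact: v0 (mem_index_enum j).
rewrite -(ler_pM2r v_gt0) mulr_sumr.
have le_col j : `|z| * `|v 0 j| <= \sum_i `|v 0 i| * `|A i j|.
  move/rowP/(_ j): vA; rewrite !mxE -normrM => <-.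
  apply: le_trans (ler_norm_sum _ _ _) _.
  by apply: ler_sum => i _; rewrite normrM.
apply: le_trans (ler_sum _ (fun j _ => le_col j)) _.
rewrite exchange_big mulr_sumr; apply: ler_sum => i _ /=.
by rewrite -mulr_sumr mulrC ler_wpM2r.
Qed.

Lemma row_mul_adjE (C : numClosedFieldType) n (w : 'rV[C]_n) :
  (w *m w^t*) 0 0 = \sum_j `|w 0 j| ^+ 2.
Proof. by rewrite mxE; apply: eq_bigr => j _; rewrite !mxE normCK. Qed.

Lemma row_mul_adj_gt0 (C : numClosedFieldType) n (w : 'rV[C]_n) :
  w != 0 -> 0 < (w *m w^t*) 0 0.
Proof. by rewrite -dotmxE; apply: dotmx_is_dotmx. Qed.

(** In an orthonormal basis of eigenvectors the form is a sum of squared moduli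
    weighted by the eigenvalues. *)
Lemma hermitian_form_le (C : numClosedFieldType) n (A : 'M[C]_n) (m : C)
    (w : 'rV[C]_n) :
  A \is hermsymmx -> (forall a, eigenvalue A a -> `|a| <= m) ->
  `|(w *m A *m w^t*) 0 0| <= m * (w *m w^t*) 0 0.
Proof.
move=> /hermitian_normalmx/orthomx_spectralP A_diag Am.
have P_unit := spectral_unit A.
have P_unitary := spectral_unitarymx A.
move: (spectralmx A) (spectral_diag A) A_diag P_unit P_unitary => P s A_diag.
move=> P_unit P_unitary.
have s_eigen i : eigenvalue A (s 0 i).
  apply/eigenvalueP; exists (row i P).
    rewrite -row_mul A_diag !mulmxA mulmxV // mul1mx.
    by apply/rowP => j; rewrite mul_diag_mx !mxE.
  apply/eqP => Pi0; have := row_mul i P (invmx P).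
  rewrite mulmxV // Pi0 mul0mx => /rowP/(_ i).
  by rewrite !mxE eqxx => /eqP; rewrite oner_eq0.
pose u := w *m invmx P.
have u_adj : u^t* = P *m w^t*.
  by rewrite trmx_mul map_mxM invmx_unitary // -map_trmx trmxK map_mxCK.
have -> : w *m A *m w^t* = u *m diag_mx s *m u^t*.
  by rewrite u_adj A_diag /u !mulmxA.
have -> : w *m w^t* = u *m u^t*.
  by rewrite u_adj /u mulmxA mulmxKV.
rewrite row_mul_adjE mxE mulr_sumr; apply: le_trans (ler_norm_sum _ _ _) _.
apply: ler_sum => j _; rewrite mul_mx_diag !mxE mulrAC -normCK normrM.
by rewrite ger0_norm ?exprn_ge0 // mulrC ler_wpM2r ?exprn_ge0 ?Am.
Qed.

(** * Symmetrizable matrices *)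

Lemma eigenvalue_conj_unit (F : fieldType) n (D A : 'M[F]_n) z :
  D \in unitmx -> eigenvalue (conjmx D A) z = eigenvalue A z.
Proof.
move=> D_unit; have conj_sub (E B : 'M[F]_n) : E \in unitmx ->
    {subset eigenvalue (conjmx E B) <= eigenvalue B}.
  move=> E_unit; apply: eigenvalue_conjmx; last by rewrite row_free_unit.
  by rewrite stablemx_unit.
apply/idP/idP; first exact: conj_sub.
rewrite -{1}(conjmxK A D_unit); apply: conj_sub.
by rewrite unitmx_inv.
Qed.

Section DiagonalConjugation.
Variables (F : fieldType) (n : nat) (p : 'rV[F]_n).
Hypothesis p_neq0 : forall i, p 0 i != 0.

Lemma diag_mx_unit : diag_mx p \in unitmx.
Proof. by rewrite unitmxE det_diag unitfE; apply/prodf_neq0 => i _. Qed.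

Lemma conj_diag_mxE (A : 'M[F]_n) i j :
  conjmx (diag_mx p) A i j = p 0 i * A i j / p 0 j.
Proof.
have /matrixP/(_ i j) : conjmx (diag_mx p) A *m diag_mx p = diag_mx p *m A.
  by rewrite conjumx ?diag_mx_unit // mulmxKV ?diag_mx_unit.
by rewrite mul_mx_diag mul_diag_mx 2!mxE => <-; rewrite mulfK.
Qed.

End DiagonalConjugation.

(** The hypothesis on [d] says that conjugation by the diagonal matrix of the
    [sqrtC (d i)] makes the matrix of moduli symmetric. Its quadratic form at
    the vector of moduli of an eigenvector of [A], conjugated in the same way,
    is then at least [|z|] times the squared norm, and [hermitian_form_le]
    bounds it from above. *)
Lemma norm_eigenvalue_le_of_symmetrizable (C : numClosedFieldType) n
    (A : 'M[C]_n) (d : 'I_n -> C) (m z : C) :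
  (forall i, 0 < d i) ->
  (forall i j, d i * `|A i j| = d j * `|A j i|) ->
  (forall a, eigenvalue (map_mx Num.norm A) a -> `|a| <= m) ->
  eigenvalue A z -> `|z| <= m.
Proof.
move=> d_gt0 dA Am Az.
pose p := \row_i sqrtC (d i).
have p_gt0 i : 0 < p 0 i by rewrite mxE sqrtC_gt0.
have p_neq0 i : p 0 i != 0 by rewrite gt_eqF.
have p_unit := diag_mx_unit p_neq0.
pose S := conjmx (diag_mx p) A.
pose T := conjmx (diag_mx p) (map_mx Num.norm A).
have TE i j : T i j = `|S i j|.
  rewrite !conj_diag_mxE // [map_mx _ _ _ _]mxE !normrM normfV.
  by rewrite !(gtr0_norm (p_gt0 _)).
have T_herm : T \is hermsymmx.
  apply: realsym_hermsym; last first.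
    by apply/mxOverP => i j; rewrite TE normr_real.
  apply/is_hermitianmxP; rewrite expr0 scale1r map_mx_id //.
  apply/matrixP => i j; rewrite [RHS]mxE /T !conj_diag_mxE // !mxE.
  apply/eqP; rewrite eqr_div ?sqrtC_eq0; try by rewrite gt_eqF.
  by rewrite mulrAC -expr2 [eqbRHS]mulrAC -expr2 !sqrtCK dA.
have T_le a : eigenvalue T a -> `|a| <= m.
  by rewrite eigenvalue_conj_unit //; apply: Am.
move: Az; rewrite -(eigenvalue_conj_unit _ _ p_unit).
case/eigenvalueP=> y yS y_neq0.
pose w := map_mx Num.norm y.
have ww : (w *m w^t*) 0 0 = (y *m y^t*) 0 0.
  by rewrite !row_mul_adjE; apply: eq_bigr => j _; rewrite mxE normr_id.
rewrite -(ler_pM2r (row_mul_adj_gt0 y_neq0)).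
have -> : `|z| * (y *m y^t*) 0 0 = `|(y *m S *m y^t*) 0 0|.
  rewrite yS -scalemxAl [X in _ = `|X|]mxE normrM; congr (_ * _).
  by rewrite ger0_norm // ltW ?row_mul_adj_gt0.
(* The form of [S] at [y] is compared with the form of [T] at [w] entrywise. *)
rewrite -ww; apply: le_trans (hermitian_form_le w T_herm T_le).
rewrite [in leRHS]ger0_norm; last first.
  rewrite mxE sumr_ge0 // => j _; rewrite !mxE conj_normC mulr_ge0 //.
  rewrite sumr_ge0 // => i _.
  by rewrite TE mxE mulr_ge0.
rewrite !mxE; apply: le_trans (ler_norm_sum _ _ _) _; apply: ler_sum => j _.
rewrite normrM !mxE norm_conjC conj_normC ler_wpM2r //.
apply: le_trans (ler_norm_sum _ _ _) _; apply: ler_sum => i _.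
by rewrite normrM TE [w 0 i]mxE.
Qed.

(** * Spectral radius of an integer matrix *)

Section SpectralRadiusBounds.
Variables (R : realType) (n : nat).
Implicit Type A : 'M[int]_n.

Lemma norm_complexE (z : R[i]) : `|z| = (normc z)%:C.
Proof. by case: z. Qed.

Lemma spectral_radius_ge0 A : 0 <= spectral_radius R A.
Proof. exact: bigmax_ge_id. Qed.

Lemma spectral_radius_le A (m : R) : 0 <= m ->
  (forall z : R[i], eigenvalue (complex_mx R A) z -> `|z| <= m%:C) ->
  spectral_radius R A <= m.
Proof.
rewrite /spectral_radius big_seq => m_ge0 Am; apply: bigmax_le => // z.
by rewrite mem_complex_eigenvalues => /Am; rewrite norm_complexE lecR.
Qed.

Lemma norm_eigenvalue_le_spectral_radius A (z : R[i]) :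
  eigenvalue (complex_mx R A) z -> `|z| <= (spectral_radius R A)%:C.
Proof. by move=> Az; rewrite norm_complexE lecR normc_le_spectral_radius. Qed.

End SpectralRadiusBounds.

(** * Quivers *)

Section Quiver.
Variables (n : nat) (Q : valued_cluster_quiver n).
Implicit Types (i j : 'I_n) (a : arrow Q).

Lemma arrow_from_toP i j a :
  arrow_from_to Q i j = Some a -> source a = i /\ target a = j.
Proof.
by rewrite /arrow_from_to; case: pickP => // b /andP[/eqP bi /eqP bj] [<-].
Qed.

Lemma no_two_cycle i j a b :
  arrow_from_to Q i j = Some a -> arrow_from_to Q j i = Some b -> False.
Proof.
move=> /arrow_from_toP[ai aj] /arrow_from_toP[bj bi].
have ab : a = b by apply: one_arrow; rewrite ai aj bi bj setUC.
by have := no_loop a; rewrite {1}ab bj aj eqxx.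
Qed.

(** Whichever way an edge points, the row index of an entry selects the
    component of the valuation that goes with it, so this is the defining
    condition of a valuation with the signs removed. *)
Lemma exchange_matrix_symmetrizable :
  exists2 d : 'I_n -> nat, forall i, (0 < d i)%N & forall i j,
    (d i * `|exchange_matrix Q i j| = d j * `|exchange_matrix Q j i|)%N.
Proof.
have [d [d_gt0 dv]] := symmetrizable Q; exists d => // i j; rewrite !mxE.
case ij: (arrow_from_to Q i j) => [a|];
  case ji: (arrow_from_to Q j i) => [b|] //.
- by case: (no_two_cycle ij ji).
- by have [<- <-] := arrow_from_toP ij; rewrite abszN !absz_nat dv.
- by have [<- <-] := arrow_from_toP ji; rewrite abszN !absz_nat dv.
- by rewrite !muln0.
Qed.

Lemma exchange_matrix_edge i j :
  exchange_matrix Q i j != 0 -> underlying_edge Q i j.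
Proof.
rewrite mxE /underlying_edge.
by case: (arrow_from_to Q i j) => //; case: (arrow_from_to Q j i).
Qed.

(** The row of [i] vanishes outside the component of [i], because a nonzero
    entry is an edge; hence row sums over the component are full row sums. *)
Lemma max_row_sum_components : max_row_sum Q = max_component_row_sum Q.
Proof.
apply/eqP; rewrite eqn_leq; apply/andP; split.
  apply/bigmax_leqP => i _; pose P := [set j | connect (underlying_edge Q) i j].
  have PQ : P \in components Q by apply: imset_f.
  apply: leq_trans (leq_bigmax_cond _ PQ).
  have iP : i \in P by rewrite inE connect0.
  apply: leq_trans (leq_bigmax_cond _ iP).
  rewrite (bigID (mem P)) /= [X in (_ + X)%N]big1 ?addn0 // => j.
  rewrite inE => ij; apply/eqP; rewrite absz_eq0; apply: contraNT ij => b_neq0.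
  exact/connect1/exchange_matrix_edge.
apply/bigmax_leqP => P _; apply/bigmax_leqP => i _.
apply: leq_trans (leq_bigmax i).
by rewrite [leqRHS](bigID (mem P)) leq_addr.
Qed.

Variable R : realType.

Lemma complex_adjacency_matrix :
  complex_mx R (adjacency_matrix Q) =
  map_mx Num.norm (complex_mx R (exchange_matrix Q)).
Proof. by apply/matrixP => i j; rewrite !mxE intr_norm. Qed.

Lemma exchange_le_adjacency_spectrum_radius :
  exchange_spectrum_radius R Q <= adjacency_spectrum_radius R Q.
Proof.
have [d d_gt0 db] := exchange_matrix_symmetrizable.
apply: spectral_radius_le (spectral_radius_ge0 _ _) _ => z.
apply: (norm_eigenvalue_le_of_symmetrizable (d := fun i => (d i)%:R)).
- by move=> i; rewrite ltr0n.
- move=> i j; rewrite ![complex_mx _ _ _ _]mxE -!intr_norm -!abszE.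
  by rewrite -!natrM db.
- move=> a; rewrite -complex_adjacency_matrix.
  exact: norm_eigenvalue_le_spectral_radius.
Qed.

Lemma adjacency_spectrum_radius_le_row_sum :
  adjacency_spectrum_radius R Q <= (max_row_sum Q)%:R.
Proof.
apply: spectral_radius_le => // z; rewrite rmorph_nat.
apply: norm_eigenvalue_le_row_sum => i.
rewrite (eq_bigr (fun j => `|exchange_matrix Q i j|%N%:R)).
  by rewrite -natr_sum ler_nat; apply: leq_bigmax.
by move=> j _; rewrite complex_adjacency_matrix !mxE normr_id -intr_norm -abszE.
Qed.

End Quiver.

Theorem proposition3p3 (R : realType) (n : nat) (Q : valued_cluster_quiver n) :
  let lambda := exchange_spectrum_radius R Q in
  let mu := adjacency_spectrum_radius R Q in
  let h := max_row_sum Q in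
  let r := max_component_row_sum Q in
  [/\ 0 <= lambda, lambda <= mu, mu <= h%:R & h = r].
Proof.
split; first exact: spectral_radius_ge0.
- exact: exchange_le_adjacency_spectrum_radius.
- exact: adjacency_spectrum_radius_le_row_sum.
- exact: max_row_sum_components.
Qed.
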